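(* Let $\alpha,\beta$ be dual curves $I\to\mathbb{D}^3$, and let the dual curve $\beta=\alpha+\lambda T$ be an involute of the dual curve $\alpha$, where $\{T,N,B\}$ is the dual Frenet frame of $\alpha$, $\kappa$ its dual curvature, and $\lambda(s)=(c_1-s)+\varepsilon c_2$ with $c_1,c_2\in\mathbb{R}$. If $W$ and $\overline W$ are the Darboux vectors of $\alpha$ and $\beta$, and $\Phi$ is the dual angle between $W$ and $B$, then $$\overline W=\frac{1}{\lambda\kappa}\big(W+\Phi' N\big).$$
   Context: $\mathbb{D}=\{a+\varepsilon a^*: a,a^*\in\mathbb{R}\}$, $\varepsilon^2=0$, is the commutative ring of dual numbers. $\mathbb{D}^3=\{\vec a+\varepsilon\vec a^*:\vec a,\vec a^*\in\mathbb{R}^3\}$ is the corresponding $\mathbb{D}$-module, with inner product $\langle \vec a+\varepsilon\vec a^*,\vec b+\varepsilon\vec b^*\rangle=\langle\vec a,\vec b\rangle+\varepsilon(\langle\vec a,\vec b^*\rangle+\langle\vec a^*,\vec b\rangle)$, vector product $(\vec a+\varepsilon\vec a^* )\wedge(\vec b+\varepsilon\vec b^* )=\vec a\wedge\vec b+\varepsilon(\vec a\wedge\vec b^*+\vec a^*\wedge\vec b)$ and, when $\vec a\neq0$, norm $\|\vec a+\varepsilon\vec a^*\|=\|\vec a\|+\varepsilon\langle\vec a,\vec a^*\rangle/\|\vec a\|$. A dual curve is a differentiable map $I\subset\mathbb{R}\to\mathbb{D}^3$; derivatives in $s$ (denoted $'$) are taken in the real and dual parts separately. For a unit speed dual curve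 $\alpha$, the dual Frenet frame $\{T,N,B\}$ consists of the dual tangent, principal normal and binormal; the dual curvature $\kappa=\sqrt{\langle T',T'\rangle}$ and dual torsion $\tau$ satisfy $T'=\kappa N$, $N'=-\kappa T+\tau B$, $B'=-\tau N$. For $\beta$: $\overline T=\beta'/\|\beta'\|$, $\overline B=(\beta'\wedge\beta'')/\|\beta'\wedge\beta''\|$, $\overline N=\overline B\wedge\overline T$, with curvature $\overline\kappa=\|\beta'\wedge\beta''\|/\|\beta'\|^3$ and torsion $\overline\tau=\det(\beta',\beta'',\beta''')/\|\beta'\wedge\beta''\|^2$. The Darboux vectors are $W=\tau T+\kappa B$ and $\overline W=\overline\tau\,\overline T+\overline\kappa\,\overline B$. Involute: let $\alpha,\beta:I\to\mathbb{D}^3$ be dual unit speed curves with tangents $T$ and $\overline T$. If the tangent lines of $\alpha$ are orthogonal to the tangent lines of $\beta$, that is, $\langle T,\overline T\rangle=0$, then $\beta$ is called an involute of $\alpha$. An involute is written $\beta(s)=\alpha(s)+\lambda(s)T(s)$ with $\lambda$ as in the claim, where $s$ is the arc parameter of $\alpha$. The dual angle $\Phi=\varphi+\varepsilon\varphi^*$ between $W$ and $B$ satisfies $\sin\Phi=\dfrac{\tau}{\sqrt{\kappa^2+\tau^2}}$, $\cos\Phi=\dfrac{\kappa}{\sqrt{\kappa^2+\tau^2}}$, where $\sin\Phi=\sin\varphi+\varepsilon\varphi^*\cos\varphi$ and $\cos\Phi=\cos\varphi-\varepsilon\varphi^*\sin\varphi$; $\Phi'$ is its derivative in $s$.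
   Formalization: The formula is proved only at s in I with s < c1: for s > c1 the norm of β' is −λκ and the printed formula has the wrong sign (e.g. for the unit circle), and at s = c1 the involute is singular. *)

(* Defs.v *)
From HB Require Import structures.
From mathcomp Require Import all_boot all_order all_algebra.
From mathcomp Require Import all_classical all_reals all_analysis.
From mathcomp Require Import ring.

Set Implicit Arguments.
Unset Strict Implicit.
Unset Printing Implicit Defensive.

Import Order.TTheory GRing.Theory Num.Theory.
Import numFieldNormedType.Exports.

Local Open Scope classical_set_scope.
Local Open Scope ring_scope.

(* [Dual a b] is the dual number a + eps b, with eps ^ 2 = 0. *)
Record dual (R : Type) := Dual { dre : R; ddu : R }.

Section DualRing.
Variable R : realType.

Definition pair_of_dual (x : dual R) : R * R := (dre x, ddu x).
Definition dual_of_pair (p : R * R) : dual R := Dual p.1 p.2.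

Lemma pair_of_dualK : cancel pair_of_dual dual_of_pair.
Proof. by case. Qed.

HB.instance Definition _ := Choice.copy (dual R) (can_type pair_of_dualK).

Implicit Types x y z : dual R.

Definition addd x y := Dual (dre x + dre y) (ddu x + ddu y).
Definition oppd x := Dual (- dre x) (- ddu x).
Definition muld x y := Dual (dre x * dre y) (dre x * ddu y + ddu x * dre y).

(* The units are the dual numbers with nonzero real part; by the convention of
   unitRingType the inverse is the identity elsewhere. *)
Definition unitd : pred (dual R) := fun x => dre x != 0.
Definition invd x :=
  if dre x != 0 then Dual (dre x)^-1 (- ddu x / dre x ^+ 2) else x.

Lemma adddA : associative addd.
Proof. by move=> [a b] [c d] [e f]; rewrite /addd /= !addrA. Qed.

Lemma adddC : commutative addd.
Proof. by move=> [a b] [c d]; rewrite /addd /= addrC (addrC b). Qed.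

Lemma add0d : left_id (Dual 0 0) addd.
Proof. by move=> [a b]; rewrite /addd /= !add0r. Qed.

Lemma addNd : left_inverse (Dual 0 0) oppd addd.
Proof. by move=> [a b]; rewrite /addd /= !addNr. Qed.

HB.instance Definition _ :=
  GRing.isZmodule.Build (dual R) adddA adddC add0d addNd.

Lemma muldA : associative muld.
Proof. by move=> [a b] [c d] [e f]; rewrite /muld /=; congr Dual; ring. Qed.

Lemma muldC : commutative muld.
Proof. by move=> [a b] [c d]; rewrite /muld /=; congr Dual; ring. Qed.

Lemma mul1d : left_id (Dual 1 0) muld.
Proof. by move=> [a b]; rewrite /muld /=; congr Dual; ring. Qed.

Lemma muldDl : left_distributive muld +%R.
Proof. by move=> [a b] [c d] [e f]; congr Dual => /=; ring. Qed.

Lemma oned_neq0 : Dual 1 0 != 0 :> dual R.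
Proof. by apply/eqP => -[] /eqP; rewrite oner_eq0. Qed.

HB.instance Definition _ :=
  GRing.Zmodule_isComNzRing.Build (dual R) muldA muldC mul1d muldDl oned_neq0.

Lemma mulVd : {in unitd, left_inverse 1 invd *%R}.
Proof.
move=> [a b]; rewrite unfold_in /= => a0; rewrite /invd /= a0.
congr Dual => /=; first by rewrite mulVf.
by rewrite expr2 invfM mulrA -!mulrA mulVf // mulr1 mulNr mulrC addrN.
Qed.

Lemma unitdPl x y : y * x = 1 -> unitd x.
Proof.
move=> [] yx _; apply/eqP => x0; move: yx; rewrite x0 mulr0.
by move/esym/eqP; rewrite oner_eq0.
Qed.

Lemma invd_out : {in [predC unitd], invd =1 id}.
Proof.
by move=> x; rewrite inE unfold_in => /negbTE xu; rewrite /invd xu.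
Qed.

HB.instance Definition _ :=
  GRing.ComNzRing_hasMulInverse.Build (dual R) mulVd unitdPl invd_out.

End DualRing.

(* Extensions of real functions f to dual numbers: f a + eps b f'(a). *)
Definition dsqrt (R : realType) (x : dual R) : dual R :=
  Dual (Num.sqrt (dre x)) (ddu x / (2 * Num.sqrt (dre x))).
Definition dsin (R : realType) (x : dual R) : dual R :=
  Dual (sin (dre x)) (ddu x * cos (dre x)).
Definition dcos (R : realType) (x : dual R) : dual R :=
  Dual (cos (dre x)) (- (ddu x * sin (dre x))).

Section DualVectors.
Variable R : realType.

Definition rdot (a b : 'rV[R]_3) : R := \sum_i a 0 i * b 0 i.

(* The index arithmetic is that of 'I_3, i.e. modulo 3. *)
Definition rcross (a b : 'rV[R]_3) : 'rV[R]_3 :=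
  \row_i (a 0 (i + 1) * b 0 (i + 2) - a 0 (i + 2) * b 0 (i + 1)).

(* Not `|a|, which is the supremum norm on matrices. *)
Definition rnorm (a : 'rV[R]_3) : R := Num.sqrt (rdot a a).

Implicit Types u v : 'rV[dual R]_3.

Definition vre u : 'rV[R]_3 := map_mx (@dre R) u.
Definition vdu u : 'rV[R]_3 := map_mx (@ddu R) u.
Definition dvec (a b : 'rV[R]_3) : 'rV[dual R]_3 :=
  \row_i Dual (a 0 i) (b 0 i).

Definition ddot u v : dual R :=
  Dual (rdot (vre u) (vre v)) (rdot (vre u) (vdu v) + rdot (vdu u) (vre v)).

Definition dcross u v : 'rV[dual R]_3 :=
  dvec (rcross (vre u) (vre v))
       (rcross (vre u) (vdu v) + rcross (vdu u) (vre v)).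

(* Meaningful only when vre u != 0. *)
Definition dnorm u : dual R :=
  Dual (rnorm (vre u)) (rdot (vre u) (vdu u) / rnorm (vre u)).

Definition ddet u v w : dual R :=
  \det (\matrix_(i < 3) [:: u; v; w]`_i).

End DualVectors.

Section DualCurves.
Variable R : realType.
Implicit Types (I : set R) (h Phi : R -> dual R) (gamma : R -> 'rV[dual R]_3).

Definition dderiv h (s : R) : dual R :=
  Dual (derive1 (fun t => dre (h t)) s) (derive1 (fun t => ddu (h t)) s).

Definition ddiff n I h : Prop :=
  forall k s, (k < n)%N -> I s ->
    derivable (derive1n k (fun t => dre (h t))) s 1 /\
    derivable (derive1n k (fun t => ddu (h t))) s 1.

Definition vderiv gamma (s : R) : 'rV[dual R]_3 :=
  \row_i dderiv (fun t => gamma t 0 i) s.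

(* [gamma] is n times differentiable on I. *)
Definition dual_curve n I gamma : Prop :=
  forall i, ddiff n I (fun t => gamma t 0 i).

Definition regular I gamma : Prop :=
  forall s, I s -> vre (vderiv gamma s) != 0.

Definition unit_speed I gamma : Prop :=
  forall s, I s -> dnorm (vderiv gamma s) = 1.

(* Frenet apparatus of a unit speed curve. *)
Definition frenetT gamma : R -> 'rV[dual R]_3 := vderiv gamma.
Definition frenet_kappa gamma (s : R) : dual R :=
  dsqrt (ddot (vderiv (frenetT gamma) s) (vderiv (frenetT gamma) s)).
Definition frenetN gamma (s : R) : 'rV[dual R]_3 :=
  (frenet_kappa gamma s)^-1 *: vderiv (frenetT gamma) s.
Definition frenetB gamma (s : R) : 'rV[dual R]_3 :=
  dcross (frenetT gamma s) (frenetN gamma s).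
(* From B' = - tau N and <N, N> = 1. *)
Definition frenet_tau gamma (s : R) : dual R :=
  - ddot (vderiv (frenetB gamma) s) (frenetN gamma s).
Definition frenetW gamma (s : R) : 'rV[dual R]_3 :=
  frenet_tau gamma s *: frenetT gamma s +
  frenet_kappa gamma s *: frenetB gamma s.

(* T' is nowhere purely dual, so kappa is invertible and N is defined. *)
Definition has_frenet_frame I gamma : Prop :=
  forall s, I s -> vre (vderiv (frenetT gamma) s) != 0.

(* Frenet apparatus of a regular curve in an arbitrary parameter. *)
Definition tangent gamma (s : R) : 'rV[dual R]_3 :=
  (dnorm (vderiv gamma s))^-1 *: vderiv gamma s.
Definition binormal gamma (s : R) : 'rV[dual R]_3 :=
  let w := dcross (vderiv gamma s) (vderiv (vderiv gamma) s) in
  (dnorm w)^-1 *: w.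
Definition normal gamma (s : R) : 'rV[dual R]_3 :=
  dcross (binormal gamma s) (tangent gamma s).
Definition curvature gamma (s : R) : dual R :=
  dnorm (dcross (vderiv gamma s) (vderiv (vderiv gamma) s)) /
  dnorm (vderiv gamma s) ^+ 3.
Definition torsion gamma (s : R) : dual R :=
  ddet (vderiv gamma s) (vderiv (vderiv gamma) s)
       (vderiv (vderiv (vderiv gamma)) s) /
  dnorm (dcross (vderiv gamma s) (vderiv (vderiv gamma) s)) ^+ 2.
Definition darboux gamma (s : R) : 'rV[dual R]_3 :=
  torsion gamma s *: tangent gamma s + curvature gamma s *: binormal gamma s.

(* [beta] is parametrized by the arc parameter of [alpha], hence is not of unit
   speed itself: its tangent is beta' / ||beta'||. *)
Definition involute I (alpha beta : R -> 'rV[dual R]_3) : Prop :=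
  regular I beta /\
  forall s, I s -> ddot (frenetT alpha s) (tangent beta s) = 0.

(* [Phi] is a differentiable dual angle between W and B along [gamma]. *)
Definition darboux_angle I gamma Phi : Prop :=
  ddiff 1 I Phi /\
  forall s, I s ->
    let k := frenet_kappa gamma s in
    let t := frenet_tau gamma s in
    dsin (Phi s) = t / dsqrt (k ^+ 2 + t ^+ 2) /\
    dcos (Phi s) = k / dsqrt (k ^+ 2 + t ^+ 2).

End DualCurves.

(* Main.v *)
(* Write T = alpha', P = T', Q = P', S = Q'. Since lambda' = -1, the involute
   has beta' = lambda P, beta'' = lambda Q - P and beta''' = lambda S - 2 Q, so
   its Darboux vector is a rational expression in lambda, P /\ Q and
   det(P, Q, S) = <P /\ Q, S>. Differentiating <T, T> = 1 three times gives
   P /\ Q = kappa ^ 2 (tau T + kappa B) = kappa ^ 2 W and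
   det(P, Q, S) = kappa ^ 3 (kappa tau' - tau kappa'), while differentiating
   kappa sin Phi = tau cos Phi gives
   Phi' (kappa ^ 2 + tau ^ 2) = kappa tau' - tau kappa'. *)
Require Import Defs.
From mathcomp Require Import all_boot all_order all_algebra.
From mathcomp Require Import all_classical all_reals all_analysis.
From mathcomp Require Import ring.
Set Implicit Arguments.
Unset Strict Implicit.
Unset Printing Implicit Defensive.
Import Order.TTheory GRing.Theory Num.Theory.
Import numFieldNormedType.Exports.
Local Open Scope classical_set_scope.
Local Open Scope ring_scope.

(** * Algebra of dual numbers and dual vectors *)

Section DualAlgebra.
Variable R : realType.
Implicit Types (x y : dual R) (u v w : 'rV[dual R]_3).

Lemma dual_eqP x y : dre x = dre y -> ddu x = ddu y -> x = y.
Proof. by case: x y => [a b] [c d] /= -> ->. Qed.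

Lemma dual_unitE x : (x \is a GRing.unit) = (dre x != 0).
Proof. by []. Qed.

(** 2 is invertible among the dual numbers. This halves the derivative of a square such as <T, T> or
    [kappa] ^ 2. *)
Lemma addxx_inj x y : x + x = y + y -> x = y.
Proof.
case: x y => [a b] [c d] [ac bd].
by congr Dual; apply: (mulIf (x := 2)); rewrite ?pnatr_eq0 // !mulr_natr.
Qed.

Lemma dreD x y : dre (x + y) = dre x + dre y.
Proof. by []. Qed.

Lemma dreM x y : dre (x * y) = dre x * dre y.
Proof. by []. Qed.

Lemma dreX x n : dre (x ^+ n) = dre x ^+ n.
Proof. by elim: n => // n IH; rewrite !exprS dreM IH. Qed.

(** The dual part of [dsqrt] divides by the square root of the real part, whence the strict
    inequality. *)
Lemma dsqrt_sqr x : 0 < dre x -> dsqrt x ^+ 2 = x.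
Proof.
move=> x0; have s0 : Num.sqrt (dre x) != 0 by rewrite gt_eqF // sqrtr_gt0.
rewrite expr2; apply: dual_eqP => /=; first by rewrite -expr2 sqr_sqrtr // ltW.
by field.
Qed.

Lemma sqr_dsqrt x : 0 < dre x -> dsqrt (x ^+ 2) = x.
Proof.
move=> x0; rewrite expr2; apply: dual_eqP => /=.
  by rewrite -expr2 sqrtr_sqr gtr0_norm.
by rewrite -expr2 sqrtr_sqr gtr0_norm //; field; rewrite gt_eqF.
Qed.

Lemma dsqrt_gt0 x : 0 < dre x -> 0 < dre (dsqrt x).
Proof. by move=> x0; rewrite /= sqrtr_gt0. Qed.

Lemma big_ord3 (V : zmodType) (F : 'I_3 -> V) : \sum_i F i = F 0 + F 1 + F 2.
Proof.
rewrite !big_ord_recl big_ord0 addr0 addrA.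
by congr (F _ + F _ + F _); apply: val_inj.
Qed.

Lemma rV3P (V : Type) (a b : 'rV[V]_3) :
  a 0 0 = b 0 0 -> a 0 1 = b 0 1 -> a 0 2 = b 0 2 -> a = b.
Proof.
move=> h0 h1 h2; apply/rowP => -[[|[|[|//]]] hi].
- by rewrite (_ : Ordinal hi = 0) //; apply: val_inj.
- by rewrite (_ : Ordinal hi = 1) //; apply: val_inj.
- by rewrite (_ : Ordinal hi = 2) //; apply: val_inj.
Qed.

Lemma ddotE u v : ddot u v = \sum_i u 0 i * v 0 i.
Proof.
by rewrite big_ord3 /ddot /rdot !big_ord3 !mxE; apply: dual_eqP => //=; ring.
Qed.

(** Naming the two cyclic successors of [i] serves both the three explicit coordinates and arguments
    that treat all coordinates at once. *)
Lemma dcrossE u v i j k : i + 1 = j -> i + 2 = k ->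
  dcross u v 0 i = u 0 j * v 0 k - u 0 k * v 0 j.
Proof. by move=> <- <-; rewrite !mxE; apply: dual_eqP => //=; ring. Qed.

Lemma dcross0E u v : dcross u v 0 0 = u 0 1 * v 0 2 - u 0 2 * v 0 1.
Proof. by apply: dcrossE; apply: val_inj. Qed.

Lemma dcross1E u v : dcross u v 0 1 = u 0 2 * v 0 0 - u 0 0 * v 0 2.
Proof. by apply: dcrossE; apply: val_inj. Qed.

Lemma dcross2E u v : dcross u v 0 2 = u 0 0 * v 0 1 - u 0 1 * v 0 0.
Proof. by apply: dcrossE; apply: val_inj. Qed.

Lemma det_mx33 (K : comNzRingType) (A : 'M[K]_3) :
  \det A = (A 0 1 * A 1 2 - A 0 2 * A 1 1) * A 2 0
    + (A 0 2 * A 1 0 - A 0 0 * A 1 2) * A 2 1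
    + (A 0 0 * A 1 1 - A 0 1 * A 1 0) * A 2 2.
Proof.
pose E (i j : nat) := A (inord i) (inord j).
(* Entries become functions of natural numbers, so that the indices of nested minors reduce by
   computation. *)
have AE i j : A i j = E i j by rewrite /E !inord_val.
rewrite (expand_det_row _ 0) !big_ord_recl big_ord0 /cofactor.
rewrite !(expand_det_row _ 0) !big_ord_recl !big_ord0 /cofactor !det_mx11.
rewrite !mxE !AE /= /bump !addn0 !add0n !modn_small //; ring.
Qed.

Let rVDE u v i : (u + v) 0 i = u 0 i + v 0 i. Proof. exact: mxE. Qed.
Let rVNE u i : (- u) 0 i = - u 0 i. Proof. exact: mxE. Qed.
Let rVZE x u i : (x *: u) 0 i = x * u 0 i. Proof. exact: mxE. Qed.

(** Expands vector expressions into dual coordinates, where identities become polynomial and [ring]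
    decides them. *)
Let coordE :=
  (ddotE, dcross0E, dcross1E, dcross2E, rVDE, rVNE, rVZE, @big_ord3).

Lemma ddetE u v w : ddet u v w = ddot (dcross u v) w.
Proof. by rewrite /ddet det_mx33 !coordE !mxE. Qed.

Lemma dnorm_dsqrt u : dnorm u = dsqrt (ddot u u).
Proof.
apply: dual_eqP => //=.
rewrite (_ : rdot (vdu u) (vre u) = rdot (vre u) (vdu u)); last first.
  by apply: eq_bigr => i _; rewrite mulrC.
by rewrite /rnorm invfM mulrA; congr (_ * _); field.
Qed.

Lemma dre_ddot_gt0 u : vre u != 0 -> 0 < dre (ddot u u).
Proof.
move=> u0; rewrite lt_neqAle sumr_ge0 ?andbT; last first.
  by move=> i _; rewrite -expr2 sqr_ge0.
apply: contra u0; rewrite eq_sym psumr_eq0; last first.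
  by move=> i _; rewrite -expr2 sqr_ge0.
move/allP => h; apply/eqP/rowP => i; rewrite [RHS]mxE.
by apply/eqP; rewrite -[_ == 0]orbb -mulf_eq0 (implyP (h i (mem_index_enum i))).
Qed.

Lemma ddotC u v : ddot u v = ddot v u.
Proof. by rewrite !coordE; ring. Qed.

Lemma ddotDl u v w : ddot (u + v) w = ddot u w + ddot v w.
Proof. by rewrite !coordE; ring. Qed.

Lemma ddotDr u v w : ddot w (u + v) = ddot w u + ddot w v.
Proof. by rewrite ![ddot w _]ddotC ddotDl. Qed.

Lemma ddotZl x u v : ddot (x *: u) v = x * ddot u v.
Proof. by rewrite !coordE; ring. Qed.

Lemma ddotZr x u v : ddot u (x *: v) = x * ddot u v.
Proof. by rewrite ![ddot u _]ddotC ddotZl. Qed.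

Lemma dcrossDr u v w : dcross u (v + w) = dcross u v + dcross u w.
Proof. by apply: rV3P; rewrite !coordE; ring. Qed.

Lemma dcrossZl x u v : dcross (x *: u) v = x *: dcross u v.
Proof. by apply: rV3P; rewrite !coordE; ring. Qed.

Lemma dcrossZr x u v : dcross u (x *: v) = x *: dcross u v.
Proof. by apply: rV3P; rewrite !coordE; ring. Qed.

Lemma dcrossxx u : dcross u u = 0.
Proof. by apply: rV3P; rewrite !coordE mxE; ring. Qed.

Lemma ddot0l u : ddot 0 u = 0.
Proof. by rewrite -(scale0r u) ddotZl mul0r. Qed.

Lemma ddot_dcross_l u v : ddot (dcross u v) u = 0.
Proof. by rewrite !coordE; ring. Qed.

Lemma ddot_dcross_r u v : ddot (dcross u v) v = 0.
Proof. by rewrite !coordE; ring. Qed.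

Lemma ddot_dcrossCA u v w : ddot (dcross u w) v = - ddot (dcross u v) w.
Proof. by rewrite !coordE; ring. Qed.

(** This is <u, u> x = <u, x> u - u /\ (u /\ x) for x = v /\ w, with the inner triple product
    expanded. For u = T it resolves P /\ Q along the frame. *)
Lemma dcross_dot u v w : ddot u u *: dcross v w =
  ddot (dcross u v) w *: u + ddot u v *: dcross u w - ddot u w *: dcross u v.
Proof. by apply: rV3P; rewrite !coordE; ring. Qed.

(** Lagrange's identity, which persists over the dual numbers because it is polynomial. *)
Lemma ddot_dcross_sqr u v : ddot (dcross u v) (dcross u v) =
  ddot u u * ddot v v - ddot u v ^+ 2.
Proof. by rewrite !coordE; ring. Qed.

End DualAlgebra.

Section DualCalculus.
Variable R : realType.
Implicit Types (f g : R -> dual R) (gamma delta : R -> 'rV[dual R]_3).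

(** Asserts existence along with the value, whereas [dderiv] is total and says nothing of
    differentiability. *)
Definition is_dderiv f (s : R) (l : dual R) : Prop :=
  is_derive s 1 (fun t => dre (f t)) (dre l) /\
  is_derive s 1 (fun t => ddu (f t)) (ddu l).

Lemma is_dderiv_Dual f (s a b : R) : is_derive s 1 (fun t => dre (f t)) a ->
  is_derive s 1 (fun t => ddu (f t)) b -> is_dderiv f s (Dual a b).
Proof. by []. Qed.

Lemma is_dderivE f s l : is_dderiv f s l -> dderiv f s = l.
Proof.
case=> h1 h2; apply: dual_eqP => /=; rewrite derive1E; exact: derive_val.
Qed.

Lemma is_dderiv_unique f s l l' : is_dderiv f s l -> is_dderiv f s l' -> l = l'.
Proof. by move=> /is_dderivE <- /is_dderivE <-. Qed.

(** On an open set, equality on [I] is equality near [s]. Identities known only on [I] can therefore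
    be differentiated. *)
Lemma is_dderiv_ext (I : set R) f g s l : open I -> I s ->
  (forall t, I t -> f t = g t) -> is_dderiv f s l -> is_dderiv g s l.
Proof.
move=> oI Is fg; have near_fg : \forall t \near s, f t = g t.
  by apply: (filterS fg); exact: open_nbhs_nbhs.
by case=> h1 h2; split;
  [apply: near_eq_is_derive h1|apply: near_eq_is_derive h2];
  apply: filterS near_fg => t ->.
Qed.

Lemma is_derive_eq_val (h : R -> R) (s a b : R) :
  is_derive s 1 h a -> a = b -> is_derive s 1 h b.
Proof. by move=> ? <-. Qed.

Lemma is_dderiv_cst c s : is_dderiv (fun=> c) s 0.
Proof. by split; apply: is_derive_cst. Qed.

Lemma is_dderivD f g s l m : is_dderiv f s l -> is_dderiv g s m ->
  is_dderiv (fun t => f t + g t) s (l + m).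
Proof. by case=> f1 f2 [g1 g2]; split; apply: is_deriveD. Qed.

Lemma is_dderivM f g s l m : is_dderiv f s l -> is_dderiv g s m ->
  is_dderiv (fun t => f t * g t) s (f s * m + l * g s).
Proof.
case=> f1 f2 [g1 g2]; split.
  refine (is_derive_eq_val (is_deriveM f1 g1) _).
  by rewrite /GRing.scale /=; ring.
refine (is_derive_eq_val (is_deriveD (is_deriveM f1 g2) (is_deriveM f2 g1)) _).
by rewrite /GRing.scale /=; ring.
Qed.

(** Existence suffices: the value is recovered later by differentiating the square of the root. *)
Lemma is_dderiv_dsqrt f s l : 0 < dre (f s) -> is_dderiv f s l ->
  exists m, is_dderiv (fun t => dsqrt (f t)) s m.
Proof.
move=> f0 [f1 f2].
have h1 : is_derive s 1 (fun t => Num.sqrt (dre (f t))) _ :=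
  is_derive1_comp (is_derive1_sqrt f0) f1.
have n0 : 2 * Num.sqrt (dre (f s)) != 0.
  by rewrite mulf_neq0 ?pnatr_eq0 // gt_eqF // sqrtr_gt0.
have h2 := is_deriveM (is_derive_cst (2 : R) s (1 : R)) h1.
have {}h2 := is_deriveM f2
  (is_deriveV (f := fun t => 2 * Num.sqrt (dre (f t))) (x := s) n0 h2).
by eexists; refine (is_dderiv_Dual (f := fun t => dsqrt (f t)) h1 h2).
Qed.

(** Differentiability comes from the explicit real and dual parts of the inverse, valid at units
    only; the value then follows by differentiating f f^-1 = 1. *)
Lemma is_dderivV (I : set R) f s l : open I -> I s ->
  (forall t, I t -> f t \is a GRing.unit) -> is_dderiv f s l ->
  is_dderiv (fun t => (f t)^-1) s (- l * (f s)^-1 ^+ 2).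
Proof.
move=> oI Is fU fl.
have fV t : I t ->
    Dual (dre (f t))^-1 (- ddu (f t) * (dre (f t) * dre (f t))^-1) = (f t)^-1.
  move=> /fU; rewrite dual_unitE => ft.
  by rewrite [RHS]/GRing.inv /= /invd ft expr2.
have fs0 : dre (f s) != 0 := fU s Is.
have [m fm] : exists m, is_dderiv (fun t => (f t)^-1) s m.
  case: fl => f1 f2.
  have h1 := is_deriveV (f := fun t => dre (f t)) (x := s) fs0 f1.
  have h2 := is_deriveM (is_deriveN f2)
    (is_deriveV (f := fun t => dre (f t) * dre (f t)) (x := s)
       (mulf_neq0 fs0 fs0) (is_deriveM f1 f1)).
  eexists; apply: (is_dderiv_ext oI Is fV).
  exact: (is_dderiv_Dual (f := fun t => Dual _ _) h1 h2).
have : is_dderiv (fun t => f t * (f t)^-1) s 0.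
  apply: is_dderiv_ext oI Is _ (is_dderiv_cst 1 s) => t /fU ft.
  by rewrite divrr.
move/(is_dderiv_unique (is_dderivM fl fm)) => h.
rewrite (_ : - l * _ = m) //.
rewrite -[m](mulKr (fU s Is)) -[f s * m](addrK (l * (f s)^-1)) h; ring.
Qed.

Lemma is_dderiv_dsin f s l : is_dderiv f s l ->
  is_dderiv (fun t => dsin (f t)) s (l * dcos (f s)).
Proof.
case=> f1 f2.
have s1 := is_derive1_comp (is_derive_sin (dre (f s))) f1.
have c1 := is_derive1_comp (is_derive_cos (dre (f s))) f1.
split.
  by refine (is_derive_eq_val s1 _); rewrite /= mulrC.
refine (is_derive_eq_val (is_deriveM f2 c1) _).
by rewrite /GRing.scale /=; ring.
Qed.

Lemma is_dderiv_dcos f s l : is_dderiv f s l ->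
  is_dderiv (fun t => dcos (f t)) s (- l * dsin (f s)).
Proof.
case=> f1 f2.
have s1 := is_derive1_comp (is_derive_sin (dre (f s))) f1.
have c1 := is_derive1_comp (is_derive_cos (dre (f s))) f1.
split.
  by refine (is_derive_eq_val c1 _); rewrite /=; ring.
refine (is_derive_eq_val (is_deriveN (is_deriveM f2 s1)) _).
by rewrite /GRing.scale /=; ring.
Qed.

Definition is_vderiv gamma (s : R) (v : 'rV[dual R]_3) : Prop :=
  forall i, is_dderiv (fun t => gamma t 0 i) s (v 0 i).

Lemma is_vderivE gamma s v : is_vderiv gamma s v -> vderiv gamma s = v.
Proof. by move=> h; apply/rowP => i; rewrite mxE; apply: is_dderivE. Qed.

Lemma is_vderiv_ext (I : set R) gamma delta s v : open I -> I s ->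
  (forall t, I t -> gamma t = delta t) ->
  is_vderiv gamma s v -> is_vderiv delta s v.
Proof.
by move=> oI Is gd gv i; apply: is_dderiv_ext oI Is _ (gv i) => t /gd ->.
Qed.

Lemma is_vderivD gamma delta s u v :
  is_vderiv gamma s u -> is_vderiv delta s v ->
  is_vderiv (fun t => gamma t + delta t) s (u + v).
Proof.
move=> gu dv i; rewrite mxE.
under [X in is_dderiv X]funext do rewrite mxE.
exact: is_dderivD (gu i) (dv i).
Qed.

Lemma is_vderivZ f gamma s l v : is_dderiv f s l -> is_vderiv gamma s v ->
  is_vderiv (fun t => f t *: gamma t) s (f s *: v + l *: gamma s).
Proof.
move=> fl gv i; rewrite !mxE.
under [X in is_dderiv X]funext do rewrite mxE.
exact: is_dderivM fl (gv i).
Qed.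

Lemma is_dderiv_ddot gamma delta s u v :
  is_vderiv gamma s u -> is_vderiv delta s v ->
  is_dderiv (fun t => ddot (gamma t) (delta t)) s
    (ddot (gamma s) v + ddot u (delta s)).
Proof.
move=> gu dv; under [X in is_dderiv X]funext do rewrite ddotE big_ord3.
rewrite !ddotE -big_split /= big_ord3.
by do !apply: is_dderivD; apply: is_dderivM.
Qed.

Lemma is_vderiv_dcross gamma delta s u v :
  is_vderiv gamma s u -> is_vderiv delta s v ->
  is_vderiv (fun t => dcross (gamma t) (delta t)) s
    (dcross (gamma s) v + dcross u (delta s)).
Proof.
move=> gu dv.
suff h i j k : i + 1 = j -> i + 2 = k ->
    is_dderiv (fun t => dcross (gamma t) (delta t) 0 i) s
      ((dcross (gamma s) v + dcross u (delta s)) 0 i).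
  by move=> i; apply: h.
move=> ij ik; rewrite mxE.
under [X in is_dderiv X]funext do rewrite (dcrossE _ _ ij ik) -mulNr.
rewrite !(dcrossE _ _ ij ik).
(* The minus sign becomes a constant factor, so that the product rule covers it. *)
have dN t : - gamma t 0 k = -1 * gamma t 0 k by rewrite mulN1r.
under [X in is_dderiv X]funext do rewrite dN.
have := is_dderivD (is_dderivM (gu j) (dv k))
  (is_dderivM (is_dderivM (is_dderiv_cst (-1) s) (gu k)) (dv j)).
congr (is_dderiv _ s _); ring.
Qed.

(** Trades one order of differentiability for one derivative; iterated, it yields the successive
    derivatives of a curve. *)
Lemma dual_curveS n (I : set R) gamma : dual_curve n.+1 I gamma ->
  (forall s, I s -> is_vderiv gamma s (vderiv gamma s)) /\
  dual_curve n I (vderiv gamma).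
Proof.
move=> gI; split=> [s Is i|i k s kn Is].
  have [h1 h2] := gI i 0 s isT Is.
  by split; rewrite mxE /= derive1E; apply: derivableP.
have [] := gI i k.+1 s kn Is; rewrite !derive1Sn => h1 h2.
by split; [move: h1|move: h2]; congr (derivable (derive1n k _) s 1);
  apply/funext => t; rewrite mxE.
Qed.

End DualCalculus.

(** * Frenet identities of a unit speed dual curve *)

Section UnitSpeedCurve.
Variables (R : realType) (I : set R) (alpha T P Q S : R -> 'rV[dual R]_3).
Hypotheses (openI : open I) (alpha_unit : unit_speed I alpha).
Hypotheses (alphaF : has_frenet_frame I alpha).
Hypotheses (dalpha : forall t, I t -> is_vderiv alpha t (T t)).
Hypotheses (dT : forall t, I t -> is_vderiv T t (P t)).
Hypotheses (dP : forall t, I t -> is_vderiv P t (Q t)).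
Hypotheses (dQ : forall t, I t -> is_vderiv Q t (S t)).

Local Notation kappa := (frenet_kappa alpha).
Local Notation tau := (frenet_tau alpha).
(** The determinant of T, P, Q, which turns out to be [kappa] ^ 2 [tau]. *)
Local Notation D t := (ddot (dcross (T t) (P t)) (Q t)).

Lemma frenetTE t : I t -> frenetT alpha t = T t.
Proof. by move=> It; apply/is_vderivE/dalpha. Qed.

Lemma vderiv_frenetTE t : I t -> vderiv (frenetT alpha) t = P t.
Proof.
move=> It; apply: is_vderivE; apply: is_vderiv_ext openI It _ (dT It) => u Iu.
by rewrite frenetTE.
Qed.

Lemma frenet_kappaE t : I t -> kappa t = dsqrt (ddot (P t) (P t)).
Proof. by move=> It; rewrite /frenet_kappa vderiv_frenetTE. Qed.

Lemma ddot_curvature_gt0 t : I t -> 0 < dre (ddot (P t) (P t)).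
Proof.
by move=> It; apply: dre_ddot_gt0; rewrite -vderiv_frenetTE //; apply: alphaF.
Qed.

Lemma ddot_tangent t : I t -> ddot (T t) (T t) = 1.
Proof.
move=> It; have := alpha_unit It.
rewrite dnorm_dsqrt (is_vderivE (dalpha It)) => T1.
(* The positivity needed to square the root is read off from the root itself, whose real part is
   1. *)
rewrite -[LHS]dsqrt_sqr ?T1 ?expr1n // -sqrtr_gt0.
by rewrite -[Num.sqrt _]/(dre (dsqrt _)) T1 ltr01.
Qed.

Lemma ddot_tangent_deriv t : I t -> ddot (T t) (P t) = 0.
Proof.
move=> It; apply: addxx_inj; rewrite addr0 {2}ddotC.
apply: (is_dderiv_unique (is_dderiv_ddot (dT It) (dT It))).
by apply: is_dderiv_ext openI It _ (is_dderiv_cst 1 t) => u /ddot_tangent.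
Qed.

Lemma ddot_tangent_deriv2 t : I t -> ddot (T t) (Q t) = - ddot (P t) (P t).
Proof.
move=> It; apply/eqP; rewrite -addr_eq0; apply/eqP.
apply: (is_dderiv_unique (is_dderiv_ddot (dT It) (dP It))).
by apply: is_dderiv_ext openI It _ (is_dderiv_cst 0 t) => u /ddot_tangent_deriv.
Qed.

(** Derivative of <T, Q> + <P, P> = 0: one <P, Q> comes from the first term and two from the
    second. *)
Lemma ddot_tangent_deriv3 t : I t ->
  ddot (T t) (S t) = - (3 * ddot (P t) (Q t)).
Proof.
move=> It.
have h0 : is_dderiv (fun u => ddot (T u) (Q u) + ddot (P u) (P u)) t 0.
  apply: is_dderiv_ext openI It _ (is_dderiv_cst 0 t) => u Iu.
  by rewrite ddot_tangent_deriv2 // addNr.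
have := is_dderivD (is_dderiv_ddot (dT It) (dQ It))
  (is_dderiv_ddot (dP It) (dP It)).
move=> /is_dderiv_unique/(_ h0).
rewrite (ddotC (Q t)) => h.
apply/eqP; rewrite -addr_eq0; apply/eqP.
by rewrite -[RHS]h; ring.
Qed.

(** In [dcross_dot] with u = T, the term in T /\ Q drops out by <T, P> = 0. Since T /\ P = [kappa]
    B, the right side is [kappa] ^ 2 W. *)
Lemma dcross_deriv t : I t -> dcross (P t) (Q t) =
  D t *: T t + ddot (P t) (P t) *: dcross (T t) (P t).
Proof.
move=> It; have := dcross_dot (T t) (P t) (Q t).
rewrite ddot_tangent // ddot_tangent_deriv // ddot_tangent_deriv2 //.
by rewrite scale1r scale0r addr0 scaleNr opprK.
Qed.

Lemma frenet_kappa_gt0 t : I t -> 0 < dre (kappa t).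
Proof.
by move=> It; rewrite frenet_kappaE //; apply/dsqrt_gt0/ddot_curvature_gt0.
Qed.

Lemma frenet_kappa_sqr t : I t -> kappa t ^+ 2 = ddot (P t) (P t).
Proof.
by move=> It; rewrite frenet_kappaE // dsqrt_sqr // ddot_curvature_gt0.
Qed.

Lemma frenet_kappa_unit t : I t -> kappa t \is a GRing.unit.
Proof. by move=> It; rewrite dual_unitE gt_eqF // frenet_kappa_gt0. Qed.

Lemma sqr_kappa_tau_gt0 t : I t -> 0 < dre (kappa t ^+ 2 + tau t ^+ 2).
Proof.
move=> It; rewrite dreD !dreX ltr_pwDl ?sqr_ge0 // exprn_gt0 //.
exact: frenet_kappa_gt0.
Qed.

(** The relation is half the derivative of [kappa] ^ 2 = <P, P>. *)
Lemma frenet_kappa_deriv t : I t ->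
  exists2 dk, is_dderiv kappa t dk & kappa t * dk = ddot (P t) (Q t).
Proof.
move=> It.
have PP := is_dderiv_ddot (dP It) (dP It).
have [dk /(is_dderiv_ext openI It (fun u Iu => esym (frenet_kappaE Iu))) kk] :=
  is_dderiv_dsqrt (ddot_curvature_gt0 It) PP.
exists dk => //; apply: addxx_inj; rewrite {2}mulrC {2}ddotC.
apply: is_dderiv_unique (is_dderivM kk kk) _.
apply: is_dderiv_ext openI It _ PP => u Iu.
by rewrite -expr2 frenet_kappa_sqr.
Qed.

(** B is T /\ (P / [kappa]). Paired with N = P / [kappa], only the part T /\ Q / [kappa] of B'
    survives, and <T /\ Q, P> = - det(T, P, Q). *)
Lemma frenet_tauE t : I t -> tau t = D t * ((kappa t)^-1 * (kappa t)^-1).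
Proof.
move=> It.
have [dk kk _] := frenet_kappa_deriv It.
have dV := is_dderivV openI It frenet_kappa_unit kk.
have BE u : I u -> dcross (T u) ((kappa u)^-1 *: P u) = frenetB alpha u.
  by move=> Iu; rewrite /frenetB /frenetN frenetTE // vderiv_frenetTE.
have /(is_vderiv_ext openI It BE)/is_vderivE dB :=
  is_vderiv_dcross (dT It) (is_vderivZ dV (dP It)).
rewrite /frenet_tau dB dcrossDr !dcrossZr !ddotDl !ddotZl.
rewrite /frenetN vderiv_frenetTE // !ddotZr.
rewrite !ddot_dcross_r (ddot_dcrossCA _ (P t)); ring.
Qed.

(** The derivative of det(T, P, Q) is <T /\ P, S>, because (T /\ P)' = T /\ Q is orthogonal to Q. *)
Lemma frenet_tau_deriv t dk : I t -> is_dderiv kappa t dk ->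
  is_dderiv tau t
    (ddot (dcross (T t) (P t)) (S t) * (kappa t)^-1 ^+ 2 -
     2 * D t * dk * (kappa t)^-1 ^+ 3).
Proof.
move=> It kk.
have dV := is_dderivV openI It frenet_kappa_unit kk.
apply: (is_dderiv_ext openI It (fun u Iu => esym (frenet_tauE Iu))).
have := is_dderivM
  (is_dderiv_ddot (is_vderiv_dcross (dT It) (dP It)) (dQ It))
  (is_dderivM dV dV).
congr (is_dderiv _ _ _).
rewrite ddotDl ddot_dcross_r dcrossxx ddot0l; ring.
Qed.

Lemma darboux_angle_deriv Phi t dk dt : darboux_angle I alpha Phi -> I t ->
  is_dderiv kappa t dk -> is_dderiv tau t dt ->
  dderiv Phi t * (kappa t ^+ 2 + tau t ^+ 2) = kappa t * dt - tau t * dk.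
Proof.
move=> [dPhi PhiE] It kk tt.
have PP : is_dderiv Phi t (dderiv Phi t).
  have [h1 h2] := dPhi 0 t isT It.
  by split; rewrite /= derive1E; apply: derivableP.
have Phi_tan u : I u -> dsin (Phi u) * kappa u = dcos (Phi u) * tau u.
  by move=> /PhiE[-> ->]; ring.
have h : dsin (Phi t) * dk + dderiv Phi t * dcos (Phi t) * kappa t =
    dcos (Phi t) * dt + - dderiv Phi t * dsin (Phi t) * tau t.
  apply: is_dderiv_unique (is_dderivM (is_dderiv_dsin PP) kk) _.
  apply: (is_dderiv_ext openI It (fun u Iu => esym (Phi_tan u Iu))).
  exact: is_dderivM (is_dderiv_dcos PP) tt.
have [sE cE] := PhiE t It.
(* Multiplication by [w] turns sin Phi and cos Phi into [tau] and [kappa]; applied to [h], it gives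
   the claim without dividing by a cosine. *)
set w := dsqrt _ in sE cE.
have wU : w \is a GRing.unit.
  by rewrite dual_unitE gt_eqF // dsqrt_gt0 // sqr_kappa_tau_gt0.
have sw : dsin (Phi t) * w = tau t by rewrite sE divrK.
have cw : dcos (Phi t) * w = kappa t by rewrite cE divrK.
apply/eqP; rewrite -subr_eq0 -[X in X - _](_ : dderiv Phi t *
  (dcos (Phi t) * w * kappa t + dsin (Phi t) * w * tau t) = _); last first.
  by rewrite sw cw; ring.
rewrite -{2}sw -{2}cw; move/eqP: h; rewrite -subr_eq0 => /eqP h.
by rewrite -[X in _ == X](mul0r w) -h; apply/eqP; ring.
Qed.

(** In [dcross_deriv], T and T /\ P are orthogonal, with squares 1 and [kappa] ^ 2. *)
Lemma ddot_dcross_deriv_sqr t : I t ->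
  ddot (dcross (P t) (Q t)) (dcross (P t) (Q t)) =
  kappa t ^+ 4 * (kappa t ^+ 2 + tau t ^+ 2).
Proof.
move=> It; have kk := mulrV (frenet_kappa_unit It).
rewrite dcross_deriv // frenet_tauE // -frenet_kappa_sqr //.
rewrite !ddotDl !ddotDr !ddotZl !ddotZr ddot_dcross_l.
rewrite (ddotC (T t) (dcross _ _)) ddot_dcross_l ddot_dcross_sqr.
rewrite ddot_tangent // ddot_tangent_deriv // -frenet_kappa_sqr //.
(* [kappa] and its inverse become independent variables, tied only by the relation that [ring] works
   modulo. *)
move: (D t) (kappa t) (kappa t)^-1 kk => d k k' kk.
by ring: kk.
Qed.

(** Pairing [dcross_deriv] with S leaves <T, S> = -3 [kappa] [kappa]' and <T /\ P, S>, the latter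
    eliminated through the formula for [tau]'. *)
Lemma ddot_dcross_deriv2 t dk dt : I t ->
  is_dderiv kappa t dk -> is_dderiv tau t dt ->
  ddot (dcross (P t) (Q t)) (S t) = kappa t ^+ 3 * (kappa t * dt - tau t * dk).
Proof.
move=> It kk tt; have kV := mulrV (frenet_kappa_unit It).
have [dk' kk' dkE] := frenet_kappa_deriv It.
rewrite (is_dderiv_unique kk' kk) in dkE.
rewrite dcross_deriv // ddotDl !ddotZl ddot_tangent_deriv3 // -dkE.
rewrite (is_dderiv_unique tt (frenet_tau_deriv It kk)) frenet_tauE //.
rewrite -frenet_kappa_sqr //.
move: (D t) (kappa t) (kappa t)^-1 (ddot _ _) kV => d k k' e kV.
by ring: kV.
Qed.

End UnitSpeedCurve.

(* Otherwise unification of distinct derivatives unfolds them down to limits. *)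
Local Opaque vderiv ddot dcross.

(** * Derivatives and Darboux vector of the involute *)

Section Involute.
Variables (R : realType) (I : set R) (alpha beta T P Q S : R -> 'rV[dual R]_3).
Variables (Phi : R -> dual R) (c1 c2 : R).
Hypotheses (openI : open I) (alpha_unit : unit_speed I alpha).
Hypotheses (alphaF : has_frenet_frame I alpha).
Hypotheses (dalpha : forall t, I t -> is_vderiv alpha t (T t)).
Hypotheses (dT : forall t, I t -> is_vderiv T t (P t)).
Hypotheses (dP : forall t, I t -> is_vderiv P t (Q t)).
Hypotheses (dQ : forall t, I t -> is_vderiv Q t (S t)).
Let lambda s := Dual (c1 - s) c2.
Hypotheses (betaE : forall t, I t -> beta t = alpha t + lambda t *: T t).
Hypotheses (PhiP : darboux_angle I alpha Phi).

Local Notation kappa := (frenet_kappa alpha).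
Local Notation tau := (frenet_tau alpha).

Lemma lambda_deriv t : is_dderiv lambda t (- 1).
Proof.
split.
  exact: is_derive_eq_val (is_deriveB (is_derive_cst c1 t 1) (is_derive_id t 1))
    (sub0r 1).
exact: is_derive_eq_val (is_derive_cst c2 t 1) (esym (oppr0 R)).
Qed.

Lemma involute_deriv t : I t -> vderiv beta t = lambda t *: P t.
Proof.
move=> It; apply: is_vderivE.
apply: (is_vderiv_ext openI It (fun u Iu => esym (betaE Iu))).
have := is_vderivD (dalpha It) (is_vderivZ (lambda_deriv t) (dT It)).
by rewrite scaleN1r addrCA subrr addr0.
Qed.

Lemma involute_deriv2 t : I t ->
  vderiv (vderiv beta) t = lambda t *: Q t - P t.
Proof.
move=> It; apply: is_vderivE.
apply: (is_vderiv_ext openI It (fun u Iu => esym (involute_deriv Iu))).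
by have := is_vderivZ (lambda_deriv t) (dP It); rewrite scaleN1r.
Qed.

Lemma involute_deriv3 t : I t ->
  vderiv (vderiv (vderiv beta)) t = lambda t *: S t - 2 *: Q t.
Proof.
move=> It; apply: is_vderivE.
apply: (is_vderiv_ext openI It (fun u Iu => esym (involute_deriv2 Iu))).
have := is_vderivD (is_vderivZ (lambda_deriv t) (dQ It))
  (is_vderivZ (is_dderiv_cst (-1) t) (dP It)).
rewrite scale0r addr0 !scaleN1r -addrA -opprD -mulr2n -scaler_nat.
congr (is_vderiv _ t _).
by apply/funext => u; rewrite scaleN1r.
Qed.

Lemma dcross_involute t : I t ->
  dcross (vderiv beta t) (vderiv (vderiv beta) t) =
  lambda t ^+ 2 *: dcross (P t) (Q t).
Proof.
move=> It; rewrite involute_deriv // involute_deriv2 // -scaleN1r.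
by rewrite dcrossDr dcrossZl !dcrossZr dcrossZl dcrossxx !scaler0 addr0 scalerA.
Qed.

(** [t < c1] makes the real part of [lambda] positive, so the root of ([lambda] [kappa]) ^ 2 is
    [lambda] [kappa] and not its opposite. *)
Lemma dnorm_involute_deriv t : I t -> t < c1 ->
  dnorm (vderiv beta t) = lambda t * kappa t.
Proof.
move=> It tc; rewrite involute_deriv // dnorm_dsqrt ddotZl ddotZr.
rewrite -(frenet_kappa_sqr openI alphaF dalpha dT It) mulrA -expr2 -exprMn.
rewrite sqr_dsqrt // dreM mulr_gt0 ?subr_gt0 //.
exact: (frenet_kappa_gt0 openI alphaF dalpha dT It).
Qed.

(** The involute has tangent N and torsion Phi' / ([lambda] [kappa]), whence the N term. In
    curvature times binormal the norm of [w] = ([lambda] [kappa]) ^ 2 W cancels, leaving W /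
    ([lambda] [kappa]). *)
Lemma darboux_involute t : I t -> t < c1 ->
  darboux beta t =
    (lambda t * kappa t)^-1 *:
      (frenetW alpha t + dderiv Phi t *: frenetN alpha t).
Proof.
move=> It tc.
have k0 := frenet_kappa_gt0 openI alphaF dalpha dT It.
have kU := frenet_kappa_unit openI alphaF dalpha dT It.
have lU : lambda t \is a GRing.unit by rewrite dual_unitE gt_eqF // subr_gt0.
have [dk kk _] := frenet_kappa_deriv openI alphaF dalpha dT dP It.
have tt := frenet_tau_deriv openI alphaF dalpha dT dP dQ It kk.
set dt := _ - _ in tt.
have dPhi := darboux_angle_deriv openI alphaF dalpha dT PhiP It kk tt.
have detE :=
  ddot_dcross_deriv2 openI alpha_unit alphaF dalpha dT dP dQ It kk tt.
have sqrE := ddot_dcross_deriv_sqr openI alpha_unit alphaF dalpha dT dP It.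
rewrite /darboux /torsion /tangent /curvature /binormal dnorm_involute_deriv //.
rewrite ddetE dcross_involute // involute_deriv3 // involute_deriv //.
(* P /\ Q is orthogonal to Q, so only the S term of beta''' enters the determinant, which [dPhi]
   then expresses through Phi'. *)
rewrite -scaleN1r ddotDr !ddotZr !ddotZl ddot_dcross_r detE -dPhi.
set w := _ *: dcross _ _.
have wE : ddot w w = (lambda t * kappa t) ^+ 4 * (kappa t ^+ 2 + tau t ^+ 2).
  by rewrite /w ddotZl ddotZr sqrE; ring.
have w0 : 0 < dre (ddot w w).
  rewrite wE dreM dreX.
  rewrite mulr_gt0 ?(sqr_kappa_tau_gt0 openI alphaF dalpha dT It) //.
  by rewrite exprn_gt0 // dreM mulr_gt0 // subr_gt0.
have nE : dnorm w ^+ 2 =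
    (lambda t * kappa t) ^+ 4 * (kappa t ^+ 2 + tau t ^+ 2).
  by rewrite dnorm_dsqrt dsqrt_sqr.
have nU : dnorm w \is a GRing.unit.
  by rewrite dual_unitE dnorm_dsqrt gt_eqF // dsqrt_gt0.
(* A factor of an invertible product is invertible. *)
have sU : kappa t ^+ 2 + tau t ^+ 2 \is a GRing.unit.
  by move: (unitrX 2 nU); rewrite nE !unitrM => /andP[].
have kV := mulrV kU; have lV := mulrV lU; have sV := mulrV sU.
have nV := mulrV nU.
have DE : ddot (dcross (T t) (P t)) (Q t) = tau t * kappa t ^+ 2.
  by rewrite (frenet_tauE openI alphaF dalpha dT dP It); ring: kV.
have n2V : (dnorm w ^+ 2)^-1 =
    ((lambda t)^-1 * (kappa t)^-1) ^+ 4 * (kappa t ^+ 2 + tau t ^+ 2)^-1.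
  by rewrite nE invrM ?unitrX ?unitrM ?lU // -exprVn invrM //
    mulrC [in LHS](mulrC _^-1).
(* The torsion involves only the squared norm, now explicit. Elsewhere the norm meets its own
   inverse, so it can be generalized. *)
rewrite n2V; move: (dnorm w) nV => n nV.
rewrite /w (dcross_deriv openI alpha_unit dalpha dT dP It) DE.
rewrite /frenetW /frenetB /frenetN (vderiv_frenetTE openI dalpha dT It).
rewrite (frenetTE dalpha It).
rewrite -(frenet_kappa_sqr openI alphaF dalpha dT It) dcrossZr.
rewrite -exprVn invrM // !(scalerDr, scalerA) [RHS]addrC.
move: sV kV lV; set s := kappa t ^+ 2 + _; move: (s) (s^-1) => s0 s1.
move: (kappa t) (kappa t)^-1 (lambda t) (lambda t)^-1 n^-1 nV
  => k k1 l l1 n1 nV sV kV lV.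
(* The coefficients of P, T and T /\ P are compared in turn. *)
congr (_ *: _ + (_ *: _ + _ *: _)).
- by ring: sV kV lV.
- by ring: nV kV lV.
- by ring: nV kV lV.
Qed.

End Involute.

Theorem theorem4 (R : realType) (I : set R) (alpha beta : R -> 'rV[dual R]_3)
    (Phi : R -> dual R) (c1 c2 : R) :
  let lambda := fun s : R => Dual (c1 - s) c2 in
  open I ->
  dual_curve 4 I alpha ->
  dual_curve 3 I beta ->
  unit_speed I alpha ->
  has_frenet_frame I alpha ->
  (forall s, I s -> beta s = alpha s + lambda s *: frenetT alpha s) ->
  involute I alpha beta ->
  darboux_angle I alpha Phi ->
  forall s, I s -> s < c1 ->
    darboux beta s =
      (lambda s * frenet_kappa alpha s)^-1 *:
        (frenetW alpha s + dderiv Phi s *: frenetN alpha s).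
Proof.
move=> lambda openI alpha4 _ alpha_unit alphaF betaE _ PhiP s Is sc.
(* Four orders of differentiability provide T, P, Q and S. *)
have [d1 /dual_curveS[d2 /dual_curveS[d3 /dual_curveS[d4 _]]]] :=
  dual_curveS alpha4.
exact: (darboux_involute openI alpha_unit alphaF d1 d2 d3 d4 betaE PhiP Is sc).
Qed.
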